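(* For a Transformer with learnable position embedding $E_{pos}$, the derivative of the loss $l$ with respect to $E_{pos}$ can be given by $$\frac{\partial l}{\partial E_{pos}}=\frac{\partial l}{\partial z},$$ where $z$ is the input of the self-attention module and $\frac{\partial l}{\partial z}$ is defined by the linear system $$\frac{\partial l}{\partial z}\,z^{T}=Q^{T}\frac{\partial l}{\partial Q}+K^{T}\frac{\partial l}{\partial K}+V^{T}\frac{\partial l}{\partial V}.$$
   Context: The self-attention module is expressed as $$Qz=q,\quad Kz=k,\quad Vz=v,\qquad \frac{\mathrm{softmax}(q\cdot k^{T})}{\sqrt{d_k}}\cdot v=h,\qquad Wh=a,$$ where $z$ is the input of the module (the embedding fed into it), $a$ is its output, $Q,K,V,W$ are the weight matrices of query, key, value and projection, $q,k,v,h$ are the intermediate feature maps, and $d_k$ is the scaling constant of the attention. The loss function can be written as $l=l(f(a),y)$, where $f$ is the remainder of the network applied to $a$ and $y$ is the label. For a variable or parameter $M$ (such as $z$, $Q$, $K$, $V$, $E_{pos}$), $\frac{\partial l}{\partial M}$ denotes the derivative (gradient) of the loss with respect to $M$. A position embedding $E_{pos}$ is learnable if it is a trainable parameter of the model (as opposed to a fixed position embedding), so that its gradient $\frac{\partial l}{\partial E_{pos}}$ is among the model gradients. *)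

(* Defs.v *)
From mathcomp Require Import all_boot all_order all_algebra.
From mathcomp Require Import all_classical all_reals all_analysis.
Import numFieldNormedType.Exports.
Set Implicit Arguments.
Unset Strict Implicit.
Unset Printing Implicit Defensive.
Local Open Scope ring_scope.

(* The gradient of a scalar function of a matrix has the shape of its argument:
   entry (i, j) is the partial derivative with respect to entry (i, j). *)
Definition gradient (R : realType) (m n : nat) (L : 'M[R]_(m, n) -> R)
    (M : 'M[R]_(m, n)) : 'M[R]_(m, n) :=
  \matrix_(i, j) 'D_(delta_mx i j) L M.

(* Softmax is normalised along each row. *)
Definition softmax (R : realType) (m n : nat) (A : 'M[R]_(m, n)) :
    'M[R]_(m, n) :=
  \matrix_(i, j) (expR (A i j) / \sum_(j' < n) expR (A i j')).

(* The scaling by sqrt dk is applied outside the softmax. *)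
Definition self_attention (R : realType) (r s m p o : nat) (dk : R)
    (W : 'M[R]_(o, m)) (Q : 'M[R]_(m, r)) (K V : 'M[R]_(p, r))
    (z : 'M[R]_(r, s)) : 'M[R]_(o, s) :=
  let q := Q *m z in
  let k := K *m z in
  let v := V *m z in
  let h := ((Num.sqrt dk)^-1 *: softmax (q *m k^T)) *m v in
  W *m h.

Definition add_position (R : realType) (X : Type) (r s : nat)
    (embed : X -> 'M[R]_(r, s)) (Epos : 'M[R]_(r, s)) (x : X) :
    'M[R]_(r, s) :=
  embed x + Epos.

Definition loss_of_input (R : realType) (T Y : Type) (r s m p o : nat) (dk : R)
    (l : T -> Y -> R) (f : 'M[R]_(o, s) -> T) (y : Y)
    (W : 'M[R]_(o, m)) (Q : 'M[R]_(m, r)) (K V : 'M[R]_(p, r))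
    (z : 'M[R]_(r, s)) : R :=
  l (f (self_attention dk W Q K V z)) y.

Definition transformer_loss (R : realType) (X T Y : Type) (r s m p o : nat)
    (dk : R) (embed : X -> 'M[R]_(r, s)) (l : T -> Y -> R)
    (f : 'M[R]_(o, s) -> T) (x : X) (y : Y)
    (W : 'M[R]_(o, m)) (Q : 'M[R]_(m, r)) (K V : 'M[R]_(p, r))
    (Epos : 'M[R]_(r, s)) : R :=
  loss_of_input dk l f y W Q K V (add_position embed Epos x).

(* Main.v *)
(* The loss depends on z, Q, K, V only through (q, k, v) = (Q z, K z, V z), on
   which it is differentiable. With g_q, g_k, g_v its gradients in q, k, v, the
   chain rule gives dl/dQ = g_q z^T, dl/dK = g_k z^T, dl/dV = g_v z^T and
   dl/dz = Q^T g_q + K^T g_k + V^T g_v; multiply the last equation by z^T. *)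
Require Import Defs.
From mathcomp Require Import all_boot all_order all_algebra.
From mathcomp Require Import all_classical all_reals all_analysis.
Import numFieldNormedType.Exports.
Import GRing.Theory Num.Theory Order.TTheory.
Local Open Scope ring_scope.
Set Implicit Arguments.
Unset Strict Implicit.
Unset Printing Implicit Defensive.

(** Only the diagonal entry at [i] of the product can be nonzero. Pairing with an elementary matrix
    under the trace thus extracts one entry, which is how gradient entries are recovered below. *)
Lemma mxtrace_mul_delta (R : pzRingType) m n (B : 'M[R]_(m, n)) i j :
  \tr (B *m delta_mx j i) = B i j.
Proof.
rewrite /mxtrace (bigD1 i) //= big1 => [|k ki]; last first.
  rewrite mxE big1 // => l _.
  by rewrite mxE (negPf ki) andbF mulr0.
rewrite addr0 mxE (bigD1 j) //= big1 => [|k kj].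
  by rewrite mxE !eqxx mulr1 addr0.
by rewrite mxE (negPf kj) mulr0.
Qed.

Section Differentiability.
Context {R : realType} {U : normedModType R}.
Implicit Types (m n p : nat) (a : U).

Lemma differentiable_mxP m n (f : U -> 'M[R]_(m, n)) a :
  differentiable f a <-> forall i j, differentiable (fun x => f x i j) a.
Proof.
split=> [df i j|df].
  apply: (@differentiable_comp _ _ _ _ f (fun M => M i j)) => //.
  exact: differentiable_coord.
(* In the basis of elementary matrices, [f] is a finite sum of scalar functions times constant
   matrices, so entrywise differentiability suffices. *)
have -> : f = \sum_(i < m) \sum_(j < n) (fun x => f x i j *: delta_mx i j).
  apply/funext => x; rewrite [LHS]matrix_sum_delta fct_sumE.
  by apply: eq_bigr => i _; rewrite fct_sumE.
apply: differentiable_sum => i; apply: differentiable_sum => j.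
exact: differentiableZl.
Qed.

Lemma differentiable_mulmx m n p (f : U -> 'M[R]_(m, n)) (g : U -> 'M[R]_(n, p))
    a : differentiable f a -> differentiable g a ->
  differentiable (fun x => f x *m g x) a.
Proof.
move=> /differentiable_mxP df /differentiable_mxP dg.
apply/differentiable_mxP => i j.
rewrite (_ : (fun _ => _) =
    \sum_(k < n) ((fun x => f x i k) * (fun x => g x k j))); last first.
  by apply/funext => x; rewrite mxE fct_sumE.
by apply: differentiable_sum => k; apply: differentiableM.
Qed.

Lemma differentiable_trmx m n (f : U -> 'M[R]_(m, n)) a :
  differentiable f a -> differentiable (fun x => (f x)^T) a.
Proof.
move=> /differentiable_mxP df; apply/differentiable_mxP => i j.
rewrite (_ : (fun _ => _) = (fun x => f x j i)) //.
by apply/funext => x; rewrite mxE.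
Qed.

Lemma differentiable_softmax m n (f : U -> 'M[R]_(m, n)) a :
  differentiable f a -> differentiable (fun x => softmax (f x)) a.
Proof.
move=> /differentiable_mxP df; apply/differentiable_mxP => i j.
have dexp k : differentiable (fun x => expR (f x i k)) a.
  apply: (@differentiable_comp _ _ _ _ (fun x => f x i k) expR) => //.
  by apply/derivable1_diffP; exact: derivable_expR.
have dsum : differentiable (fun x => \sum_(k < n) expR (f x i k)) a.
  rewrite (_ : (fun _ => _) = \sum_(k < n) (fun x => expR (f x i k))).
    exact: differentiable_sum.
  by apply/funext => x; rewrite fct_sumE.
rewrite (_ : (fun _ => _) = (fun x => expR (f x i j)) *
    (fun x => (\sum_(k < n) expR (f x i k))^-1)); last first.
  by apply/funext => x; rewrite mxE.
apply: differentiableM => //; apply: differentiableV => //.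
(* The row sum is nonzero because it contains the positive term at [j] and all its other terms are
   nonnegative. *)
rewrite gt_eqF// (bigD1 j) //= ltr_pwDl ?expR_gt0//.
by apply: sumr_ge0 => k _; exact: expR_ge0.
Qed.

End Differentiability.

(** The nonlinear part of the module: [self_attention] at [z] is by conversion this map at the
    triple [(Q *m z, K *m z, V *m z)]. *)
Definition attention_of_features (R : realType) (s m p o : nat) (dk : R)
    (W : 'M[R]_(o, m)) (qkv : 'M[R]_(m, s) * 'M[R]_(p, s) * 'M[R]_(p, s)) :
    'M[R]_(o, s) :=
  W *m (((Num.sqrt dk)^-1 *: softmax (qkv.1.1 *m qkv.1.2^T)) *m qkv.2).

Lemma differentiable_attention_of_features (R : realType) (s m p o : nat)
    (dk : R) (W : 'M[R]_(o, m))
    (qkv : 'M[R]_(m, s) * 'M[R]_(p, s) * 'M[R]_(p, s)) :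
  differentiable (attention_of_features dk W) qkv.
Proof.
have dfst (A B : normedModType R) (u : A * B) : differentiable fst u.
  by apply: linear_differentiable => v; exact: cvg_fst.
have dsnd (A B : normedModType R) (u : A * B) : differentiable snd u.
  by apply: linear_differentiable => v; exact: cvg_snd.
apply: differentiable_mulmx; first exact: differentiable_cst.
apply: differentiable_mulmx; last exact: dsnd.
apply: differentiableZ; apply: differentiable_softmax.
apply: differentiable_mulmx; last apply: differentiable_trmx;
  apply: (differentiable_comp (dfst _ _ _)); [exact: dfst | exact: dsnd].
Qed.

Lemma differentiable_pairl (R : realType) (U V W : normedModType R)
    (L : U * V -> W) u v :
  differentiable L (u, v) -> differentiable (fun u' => L (u', v)) u.
Proof.
by move=> dL; apply: (@differentiable_comp _ _ _ _ (fun u' => (u', v)) L).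
Qed.

Lemma differentiable_pairr (R : realType) (U V W : normedModType R)
    (L : U * V -> W) u v :
  differentiable L (u, v) -> differentiable (fun v' => L (u, v')) v.
Proof.
by move=> dL; apply: (@differentiable_comp _ _ _ _ (fun v' => (u, v')) L).
Qed.

(** A directional derivative sees a function only along a line, so equal restrictions to two lines
    give equal difference quotients, whether or not the limit exists. Every change of variables
    below goes through this. *)
Lemma eq_derive (R : realType) (U V W : normedModType R) (f : U -> W)
    (g : V -> W) a u b v :
  (forall h : R, f (h *: u + a) = g (h *: v + b)) -> 'D_u f a = 'D_v g b.
Proof.
move=> fg; have fgab : f a = g b by have := fg 0; rewrite !scale0r !add0r.
rewrite /derive (_ : (fun h => _) =
  (fun h => h^-1 *: ((g \o shift b) (h *: v) - g b)))//.
by apply/funext => h /=; rewrite fg fgab.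
Qed.

Lemma derive_pairl (R : realType) (U V W : normedModType R) (L : U * V -> W)
    u v w : 'D_w (fun u' => L (u', v)) u = 'D_(w, 0) L (u, v).
Proof.
apply: eq_derive => h.
by rewrite -[RHS]/(L (h *: w + u, h *: 0 + v)) scaler0 add0r.
Qed.

Lemma derive_pairr (R : realType) (U V W : normedModType R) (L : U * V -> W)
    u v w : 'D_w (fun v' => L (u, v')) v = 'D_(0, w) L (u, v).
Proof.
apply: eq_derive => h.
by rewrite -[RHS]/(L (h *: 0 + u, h *: w + v)) scaler0 add0r.
Qed.

Section Gradient.
Context {R : realType}.

(** Expand [N] in elementary matrices and use linearity of the differential: the gradient represents
    it for the Frobenius pairing, the trace of [A^T *m B]. *)
Lemma derive_gradient m n (L : 'M[R]_(m, n) -> R) M N : differentiable L M ->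
  'D_N L M = \tr ((gradient L M)^T *m N).
Proof.
move=> dL; rewrite {2}(matrix_sum_delta N) deriveE// {1}(matrix_sum_delta N).
rewrite !linear_sum; apply: eq_bigr => i _.
rewrite !linear_sum; apply: eq_bigr => j _.
by rewrite !linearZ /= mxtrace_mul_delta !mxE deriveE.
Qed.

(** Moving [A] along [delta_mx i j] moves [A *m z] along [delta_mx i j *m z]; for the Frobenius
    pairing, the adjoint of right multiplication by [z] is right multiplication by [z^T]. *)
Lemma gradient_mulmxr m n p (L : 'M[R]_(m, n) -> R) (A : 'M[R]_(m, p))
    (z : 'M[R]_(p, n)) : differentiable L (A *m z) ->
  gradient (fun B => L (B *m z)) A = gradient L (A *m z) *m z^T.
Proof.
move=> dL; apply/matrixP => i j; rewrite [LHS]mxE.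
rewrite (@eq_derive _ _ _ _ _ L A _ (A *m z) (delta_mx i j *m z)); last first.
  by move=> h; rewrite mulmxDl scalemxAl.
rewrite derive_gradient// mulmxA mxtrace_mulC mulmxA mxtrace_mul_delta.
by move: (gradient L _) => G; rewrite -[z in LHS]trmxK -trmx_mul [LHS]mxE.
Qed.

(** The adjoint of left multiplication by [A] is left multiplication by [A^T]; this produces the
    factors [Q^T], [K^T] and [V^T]. *)
Lemma mxtrace_trmx_mul_delta m n p (G : 'M[R]_(m, n)) (A : 'M[R]_(m, p)) i j :
  \tr (G^T *m (A *m delta_mx i j)) = (A^T *m G) i j.
Proof.
by rewrite mulmxA mxtrace_mul_delta -[in RHS](trmxK G) -trmx_mul [RHS]mxE.
Qed.

Lemma gradient_features r s m p
    (L : 'M[R]_(m, s) * 'M[R]_(p, s) * 'M[R]_(p, s) -> R)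
    (Q : 'M[R]_(m, r)) (K V : 'M[R]_(p, r)) (z : 'M[R]_(r, s)) :
  differentiable L (Q *m z, K *m z, V *m z) ->
  gradient (fun z => L (Q *m z, K *m z, V *m z)) z *m z^T =
  Q^T *m gradient (fun Q' => L (Q' *m z, K *m z, V *m z)) Q
  + K^T *m gradient (fun K' => L (Q *m z, K' *m z, V *m z)) K
  + V^T *m gradient (fun V' => L (Q *m z, K *m z, V' *m z)) V.
Proof.
set c := (_, _, _) => dL.
have dq : differentiable (fun q => L (q, K *m z, V *m z)) (Q *m z).
  exact: (differentiable_pairl (differentiable_pairl dL)).
have dk : differentiable (fun k => L (Q *m z, k, V *m z)) (K *m z).
  exact: (differentiable_pairr (differentiable_pairl dL)).
have dv : differentiable (fun v => L (Q *m z, K *m z, v)) (V *m z).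
  exact: (differentiable_pairr dL).
rewrite (gradient_mulmxr dq) (gradient_mulmxr dk) (gradient_mulmxr dv).
(* Both sides now end in the factor [z^T]; what remains is the chain rule for the gradient in
   [z]. *)
rewrite !mulmxA -!mulmxDl; congr (_ *m _).
apply/matrixP => i j; rewrite [LHS]mxE [RHS]mxE [X in _ = X + _]mxE.
rewrite -!mxtrace_trmx_mul_delta -!derive_gradient//.
set d := delta_mx i j.
(* Moving [z] along [d] moves the triple [c] along [(Q *m d, K *m d, V *m d)]. *)
rewrite (@eq_derive _ _ _ _ _ L _ _ c (Q *m d, K *m d, V *m d)); last first.
  by move=> h; rewrite !mulmxDr -!scalemxAr.
rewrite (derive_pairl (fun qk => L (qk, V *m z))) derive_pairl.
rewrite (derive_pairr (fun qk => L (qk, V *m z))) derive_pairl.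
rewrite derive_pairr.
(* The three partial directions, each padded with zeros, add up to the full direction, and the
   differential at [c] is additive. *)
rewrite !deriveE// -!linearD; congr ('d L c _).
by congr (_, _, _); rewrite /= ?addr0 ?add0r.
Qed.

End Gradient.

Theorem theorem3p2 (R : realType) (X T Y : Type) (r s m p o : nat) (dk : R)
    (embed : X -> 'M[R]_(r, s)) (l : T -> Y -> R) (f : 'M[R]_(o, s) -> T)
    (x : X) (y : Y)
    (W : 'M[R]_(o, m)) (Q : 'M[R]_(m, r)) (K V : 'M[R]_(p, r))
    (Epos : 'M[R]_(r, s)) :
  let z := add_position embed Epos x in
  let dl_dz := gradient (loss_of_input dk l f y W Q K V) z in
  let dl_dEpos := gradient (transformer_loss dk embed l f x y W Q K V) Epos in
  let dl_dQ :=
    gradient (fun Q' => transformer_loss dk embed l f x y W Q' K V Epos) Q in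
  let dl_dK :=
    gradient (fun K' => transformer_loss dk embed l f x y W Q K' V Epos) K in
  let dl_dV :=
    gradient (fun V' => transformer_loss dk embed l f x y W Q K V' Epos) V in
  let rhs := Q^T *m dl_dQ + K^T *m dl_dK + V^T *m dl_dV in
  0 < dk ->
  differentiable (fun a => l (f a) y) (self_attention dk W Q K V z) ->
  [/\ dl_dEpos = dl_dz,
      dl_dz *m z^T = rhs
    & row_free z^T -> forall G : 'M[R]_(r, s), G *m z^T = rhs -> G = dl_dz].
Proof.
move=> z dl_dz dl_dEpos dl_dQ dl_dK dl_dV rhs _ dlf.
have dl_dzE : dl_dz *m z^T = rhs.
  apply: (@gradient_features _ _ _ _ _
    (fun qkv => l (f (attention_of_features dk W qkv)) y)).
  apply: (@differentiable_comp _ _ _ _ (attention_of_features dk W)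
    (fun a => l (f a) y)) => //.
  exact: differentiable_attention_of_features.
(* Uniqueness: when [z^T] is row free, right multiplication by it is injective, so the linear system
   determines its solution. *)
split=> // [|/row_free_inj zinj G GE]; last by apply: zinj; rewrite GE.
(* The position embedding enters only through the translation [embed x + Epos], so a displacement of
   [Epos] is the same displacement of [z]. *)
apply/matrixP => i j; rewrite [LHS]mxE [RHS]mxE; apply: eq_derive => h.
by rewrite /transformer_loss /z /add_position addrCA.
Qed.
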